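(* Let $m$ and $n$ be positive integers. The multiplication table for the polynomial ring $\mathbb{Z}_n[x_1, x_2, \ldots, x_m]$ has $1$'s only on the diagonal (that is, for all $a, b \in \mathbb{Z}_n[x_1, x_2, \ldots, x_m]$, $ab = 1$ implies $a = b$) if and only if $n$ is a divisor of $12$.
   Context: $\mathbb{Z}_n$ denotes the ring $\mathbb{Z}/n\mathbb{Z}$ of integers modulo $n$, and $\mathbb{Z}_n[x_1,\ldots,x_m]$ is the polynomial ring in $m$ commuting variables over it. For a ring $R$, one says that the multiplication table for $R$ has $1$'s only on the diagonal (the ''diagonal property'') if, for all $a, b \in R$, $ab = 1$ implies $a = b$. *)

(* Defs.v *)
From HB Require Import structures.
From mathcomp Require Import all_boot all_order all_algebra.
From mathcomp Require Import mpoly.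

Set Implicit Arguments.
Unset Strict Implicit.
Unset Printing Implicit Defensive.

Definition diagonal_property (R : pzRingType) : Prop :=
  forall a b : R, (a * b = 1 -> a = b)%R.

(* 'I_1 with arithmetic modulo 1, i.e. the zero ring.  MathComp puts a ring
   structure only on 'I_p.+2, and 'Z_1 denotes the integers modulo 2. *)
Definition Z1 : Type := 'I_1.

HB.instance Definition _ := GRing.Zmodule.on Z1.
HB.instance Definition _ := GRing.Zmodule_isComPzRing.Build Z1
  (@Zp_mulA 1) (@Zp_mulC 1) (@Zp_mul1z 0) (@Zp_mul_addl 1).

(* The polynomial ring in m variables over the integers modulo n, for n > 0.
   A polynomial over the zero ring has all its coefficients zero, so for n = 1
   this is again the zero ring; {mpoly _[_]} only accepts nonzero rings.
   The value at n = 0 is meaningless. *)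
Definition Zn_mpoly (n m : nat) : comPzRingType :=
  if n == 1 then (Z1 : comPzRingType) else ({mpoly 'Z_n[m]} : comPzRingType).

(* Main.v *)
(** If ab = 1 and p is a prime divisor of n, then a is a unit over the domain
    F_p[x_1, ..., x_m], hence constant modulo p.  So the nonconstant
    coefficients of a are divisible by the radical of n; when n divides 12, both
    the square and the double of that radical vanish modulo n, so
    a^2 = a_0^2 = 1, because the units of Z_n are self-inverse.
    Conversely, if all units of Z_n are self-inverse then n divides 24, and for
    n = 8 or n = 24 the unit 1 + (n/4)x is not self-inverse. *)

From HB Require Import structures.
Require Import Defs.
From mathcomp Require Import all_boot all_order all_algebra.
From mathcomp Require Import mpoly ring.

Import GRing.Theory.

Section Unit.
Local Open Scope ring_scope.

Lemma map_unit_mcoeff (R : comNzRingType) (F : idomainType) (m : nat)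
    (f : {rmorphism R -> F}) (a b : {mpoly R[m]}) (k : 'X_{1..m}) :
  a * b = 1 -> k != 0%MM -> f a@_k = 0.
Proof.
move=> ab1 k0; have : map_mpoly f a \in @mpoly_unit m F.
  by apply: (@mpoly_intro_unit _ _ _ (map_mpoly f b)); rewrite -rmorphM mulrC ab1 rmorph1.
(* Over a domain, membership in [mpoly_unit] includes equality with the constant coefficient. *)
case/andP=> /eqP aE _; rewrite -mcoeff_map_mpoly aE mcoeffC.
by rewrite (negbTE k0) mulr0.
Qed.

Lemma natr_mod_eq0 (S : nzSemiRingType) (n k : nat) :
  n%:R = 0 :> S -> (k %% n)%:R = k%:R :> S.
Proof. by move=> n0; rewrite {2}(divn_eq k n) natrD natrM n0 mulr0 add0r. Qed.

(** The canonical map out of ['Z_n], a ring morphism once n vanishes in [S]. With [S] equal to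
    ['F_p] for a prime p dividing n, it is reduction modulo p. *)
Definition Zp_val (n : nat) (S : nzRingType) (x : 'Z_n) : S := (val x)%:R.

Lemma Zp_val_is_zmod_morphism (n : nat) (S : nzRingType) :
  (1 < n)%N -> n%:R = 0 :> S -> zmod_morphism (@Zp_val n S).
Proof.
move=> n1 n0; have ZpD u v : @Zp_val n S (u + v) = Zp_val _ _ u + Zp_val _ _ v.
  by rewrite /Zp_val -natrD -(natr_mod_eq0 S n (_ + _) n0) /= [X in (_ %% X)%N]Zp_cast.
by move=> x y; rewrite -{2}(subrK y x) [in RHS]ZpD addrK.
Qed.

Lemma Zp_val_is_monoid_morphism (n : nat) (S : nzRingType) :
  (1 < n)%N -> n%:R = 0 :> S -> monoid_morphism (@Zp_val n S).
Proof.
move=> n1 n0; split=> [|x y]; rewrite /Zp_val.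
  have -> : val (1 : 'Z_n) = (1 %% n)%N := val_Zp_nat n1 1.
  exact: natr_mod_eq0.
by rewrite -natrM -(natr_mod_eq0 S n (_ * _) n0) /= [X in (_ %% X)%N]Zp_cast.
Qed.

Lemma unit_mcoeff_dvd (n m p : nat) (a b : {mpoly 'Z_n[m]}) (k : 'X_{1..m}) :
  (1 < n)%N -> a * b = 1 -> k != 0%MM -> p \in primes n -> (p %| val a@_k)%N.
Proof.
move=> n1 ab1 k0; rewrite mem_primes => /and3P[pp _ pn].
have n0 : n%:R = 0 :> 'F_p.
  by apply/eqP; rewrite -(dvdn_pcharf (pchar_Fp pp)).
pose zM := GRing.isZmodMorphism.Build _ _ _ (Zp_val_is_zmod_morphism _ _ n1 n0).
pose mM := GRing.isMonoidMorphism.Build _ _ _ (Zp_val_is_monoid_morphism _ _ n1 n0).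
pose f : {rmorphism 'Z_n -> 'F_p} := HB.pack (@Zp_val n 'F_p) zM mM.
have fa0 := map_unit_mcoeff _ _ _ f _ _ _ ab1 k0.
by rewrite (dvdn_pcharf (pchar_Fp pp)) -[_%:R]/(f a@_k) fa0.
Qed.

End Unit.

(** Both x and y are multiples of the radical r of n, and n divides r^2 and 2r. With only six values
    of n, everything is checked by computation. *)
Lemma nilpotent_dvd12 (n x y : nat) : n %| 12 -> x < n -> y < n ->
    all (dvdn^~ x) (primes n) -> all (dvdn^~ y) (primes n) ->
  (n %| x * y) && (n %| x + x).
Proof.
move=> n12 xn yn px py.
have: all (fun d => all (fun u => all (fun v =>
    all (dvdn^~ u) (primes d) ==> all (dvdn^~ v) (primes d) ==>
    (d %| u * v) && (d %| u + u)) (iota 0 d)) (iota 0 d)) (divisors 12).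
  by vm_compute.
move/allP/(_ n); rewrite -dvdn_divisors // => /(_ n12) /allP /(_ x).
rewrite mem_iota => /(_ xn) /allP /(_ y); rewrite mem_iota => /(_ yn).
by rewrite px py.
Qed.

Lemma unit_dvd12 (n x y : nat) : n %| 12 -> x < n -> y < n ->
  x * y = 1 %[mod n] -> x = y.
Proof.
move=> n12 xn yn /eqP xy.
have: all (fun d => all (fun u => all (fun v =>
    (u * v == 1 %[mod d]) ==> (u == v)) (iota 0 d)) (iota 0 d)) (divisors 12).
  by vm_compute.
move/allP/(_ n); rewrite -dvdn_divisors // => /(_ n12) /allP /(_ x).
rewrite mem_iota => /(_ xn) /allP /(_ y); rewrite mem_iota => /(_ yn).
by rewrite xy => /eqP.
Qed.

Section Polynomials.
Local Open Scope ring_scope.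

Lemma Zp_nat_eq0 (n k : nat) : (1 < n)%N -> (k%:R == 0 :> 'Z_n) = (n %| k)%N.
Proof. by move=> n1; rewrite -val_eqE /= val_Zp_nat. Qed.

Lemma diagonal_dvd12 (n m : nat) :
  (1 < n)%N -> (n %| 12)%N -> diagonal_property {mpoly 'Z_n[m]}.
Proof.
move=> n1 n12 a b ab1.
have ltZ (x : 'Z_n) : (val x < n)%N by rewrite -[X in (_ < X)%N]Zp_cast // ltn_ord.
have co1 : a@_0 * b@_0 = 1 by rewrite -rmorphM /= ab1 mcoeff1 eqxx.
have ab0 : a@_0 = b@_0.
  apply/val_inj/(unit_dvd12 _ _ _ n12) => //.
  have /(congr1 val) := co1; rewrite [RHS](val_Zp_nat n1 1) => <- /=.
  by rewrite [X in _ = (_ %% X)%N]Zp_cast.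
(* The constant term is removed so that every coefficient of [d] is divisible by each prime factor
   of n; this gives d^2 = 2d = 0. *)
pose d := a - (a@_0)%:MP.
have d0 : d@_0 = 0 by rewrite mcoeffB mcoeffC eqxx mulr1 subrr.
have dP k : all (dvdn^~ (val d@_k)) (primes n).
  apply/allP=> p pn; have [->|k0] := eqVneq k 0%MM; first by rewrite d0 dvdn0.
  rewrite mcoeffB mcoeffC (negbTE k0) mulr0 subr0.
  exact: (unit_mcoeff_dvd _ _ _ _ _ _ n1 ab1 k0 pn).
have nilM k l : d@_k * d@_l = 0 /\ d@_k + d@_k = 0.
  have /andP[] := nilpotent_dvd12 _ _ _ n12 (ltZ _) (ltZ _) (dP k) (dP l).
  by rewrite -!Zp_nat_eq0 // natrM natrD !natr_Zp => /eqP-> /eqP->.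
have dd : d * d = 0.
  by apply/mpolyP=> k; rewrite mcoeffM mcoeff0 big1 // => i _; case: (nilM i.1 i.2).
have d2 : d + d = 0 by apply/mpolyP=> k; rewrite mcoeffD mcoeff0; case: (nilM k k).
have aE : a = d + (a@_0)%:MP by rewrite subrK.
clearbody d.
have aa1 : a * a = 1.
  rewrite aE mulrDl !mulrDr dd add0r (mulrC _ d) addrA -mulrDl d2 mul0r.
  by rewrite add0r -mpolyCM {2}ab0 co1.
(* Here a = a(ab) = (aa)b = b. *)
by rewrite -[a]mulr1 -ab1 mulrA aa1 mul1r.
Qed.

Lemma diagonal_coprime (n m u : nat) : (1 < n)%N ->
  diagonal_property {mpoly 'Z_n[m]} -> coprime n u -> (u * u)%N = 1 %[mod n].
Proof.
move=> n1 diag; rewrite -unitZpE // => Uu.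
have /diag /(can_inj (@mpolyCK _ _)) uV : (u%:R : 'Z_n)%:MP_[m] * (u%:R^-1)%:MP = 1.
  by rewrite -mpolyCM divrr.
have /(congr1 (@nat_of_ord _)) : u%:R * u%:R = 1%:R :> 'Z_n by rewrite {2}uV divrr.
by rewrite -natrM !val_Zp_nat.
Qed.

(** If w^3 = 0, then 1 + wX has inverse 1 - wX + w^2 X^2. When the two agree, comparing coefficients
    of X gives w = -w. *)
Lemma cube0_double0 (R : comNzRingType) (m : nat) (w : R) : (0 < m)%N ->
  diagonal_property {mpoly R[m]} -> w ^+ 3 = 0 -> w *+ 2 = 0.
Proof.
case: m => // m _ diag w3; pose y : {mpoly R[m.+1]} := w *: 'X_ord0.
have y3 : y ^+ 3 = 0 by rewrite exprZn w3 scale0r.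
have /diag : (1 + y) * (1 - y + y ^+ 2) = 1.
  have -> : (1 + y) * (1 - y + y ^+ 2) = 1 + y ^+ 3.
    by ring.
  by rewrite y3 addr0.
rewrite -addrA => /addrI; rewrite addrC => /eqP; rewrite -subr_eq opprK.
move/eqP/(congr1 (mcoeff U_(ord0))).
rewrite exprZn mcoeffD !mcoeffZ mcoeffXn mcoeffX eqxx mulr1 -mulr2n => ->.
(* The monomials X^2 and X differ in their exponent at [ord0], so the square contributes nothing. *)
case: eqP => [/mnmP/(_ ord0)|_]; last by rewrite mulr0.
by rewrite mulmnE mnm1E eqxx.
Qed.

End Polynomials.

(** If 5 is coprime to n, then n divides 5^2 - 1 = 24. Otherwise the Chinese remainder theorem gives
    u coprime to n with u = 2 modulo the 5-part of n and u = 1 modulo the rest; then u^2 = 4 modulo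
    5, which is not 1. *)
Lemma coprime_square_dvd24 (n : nat) : 0 < n ->
  (forall u, coprime n u -> u * u = 1 %[mod n]) -> n %| 24.
Proof.
move=> n0 sq; have dvdS u : coprime n u.+1 -> n %| u.+1 * u.+1 - 1.
  by move/sq/eqP; rewrite eqn_mod_dvd.
have [n5|/negbTE n5] := boolP (coprime n 5); first exact: (dvdS 4).
have {}n5 : 5 %| n by rewrite coprime_sym prime_coprime // in n5; move/negbFE: n5.
have co : coprime n`_5 n`_5^'.
  exact: coprime_partC.
pose u := chinese n`_5 n`_5^' 2 1.
have u5 : u = 2 %[mod n`_5] := chinese_modl co 2 1.
have u5' : u = 1 %[mod n`_5^'] := chinese_modr co 2 1.
have /sq u2 : coprime n u.
  rewrite -(partnC 5 n0) coprimeMl -(coprime_modr n`_5) u5 coprime_modr.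
  rewrite -(coprime_modr n`_5^') u5' coprime_modr coprimen1 andbT.
  by apply: (@pnat_coprime 5); rewrite ?part_pnat.
have d5 : 5 %| n`_5 by rewrite -{1}(expn1 5) p_part dvdn_exp2l // logn_gt0 mem_primes n0 n5.
have : u * u = 1 %[mod 5].
  by rewrite -(modn_dvdm _ n5) u2 modn_dvdm.
by rewrite -modnMml -modnMmr -(modn_dvdm u d5) u5 (modn_dvdm _ d5).
Qed.

Theorem theorem1p1 (m n : nat) (hm : 0 < m) (hn : 0 < n) :
  diagonal_property (Zn_mpoly n m) <-> n %| 12.
Proof.
rewrite /Zn_mpoly; case: eqVneq => [->|n_neq1].
  by split=> // _ a b _; rewrite [a]ord1 [b]ord1.
have n1 : 1 < n by case: n n_neq1 hn => [|[]].
split=> [diag|]; last exact: diagonal_dvd12.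
have n24 : n %| 24 by apply: coprime_square_dvd24 => // u; exact: diagonal_coprime diag.
have sub (w : nat) : n %| w ^ 3 -> n %| w * 2.
  rewrite -!(Zp_nat_eq0 _ _ n1) natrX natrM => /eqP w3.
  by apply/eqP; rewrite -[RHS](cube0_double0 _ _ _ hm diag w3) mulr_natr.
(* The divisors of 24 that do not divide 12 are 8 and 24. There w = n/4 is 2 or 6, and n divides w^3
   but not 2w, against [sub]. *)
have: all (fun d => (d %| (d %/ 4) ^ 3) && ~~ (d %| d %/ 4 * 2) || (d %| 12))
    (divisors 24) by vm_compute.
move/allP/(_ n); rewrite -dvdn_divisors // => /(_ n24) /orP[/andP[]|//].
by move/sub->.
Qed.
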